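(* Let $F,G\in\mathbb{Z}[x]\setminus\{0\}$ be coprime in $\mathbb{Q}[x]$. Then $$\mathcal{P}(F,G)\quad\Longleftrightarrow\quad F\text{ or }G\text{ is intersective}.$$
   Context: $\mathbb{N}=\{1,2,\ldots\}$. For $A\subset\mathbb{N}$ and $m\in\mathbb{Z}$, put $d_A(m)=\#\{a\in A: a\mid m\}$, which may be infinite (in particular $d_A(0)=|A|$). For $A\subset\mathbb{N}$ and $u,v\in\mathbb{Z}$ define the extended difference $\delta_A(u,v)$ by: $\delta_A(u,v)=0$ if $u=v=0$; $\delta_A(u,v)=\infty$ if exactly one of $u,v$ is zero; $\delta_A(u,v)=|d_A(u)-d_A(v)|$ if $uv\neq 0$. For $F,G\in\mathbb{Z}[x]$, $\mathcal{P}(F,G)$ denotes the property: for every infinite $A\subset\mathbb{N}$, $\limsup_{n\to\infty}\delta_A(F(n),G(n))=\infty$ ($n$ running over positive integers). A polynomial $H\in\mathbb{Z}[x]$ is intersective if for every integer $m\ge 1$ there exists $n\in\mathbb{Z}$ with $H(n)\equiv 0\pmod m$. *)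

(* Defs.v *)
From HB Require Import structures.
From mathcomp Require Import all_boot all_order all_algebra.
From mathcomp Require Import all_classical all_reals all_analysis.

Set Implicit Arguments.
Unset Strict Implicit.
Unset Printing Implicit Defensive.

Import Order.TTheory GRing.Theory Num.Theory.

Local Open Scope classical_set_scope.
Local Open Scope ring_scope.

(* R only serves to build the codomain \bar R, where [counting] and
   [limn_esup] take their values. *)
Definition divcount (R : realType) (A : set nat) (m : int) : \bar R :=
  counting [set a : nat | A a /\ (a%:Z %| m)%Z].

Definition ext_diff (R : realType) (A : set nat) (u v : int) : \bar R :=
  if (u == 0) && (v == 0) then 0%E
  else if (u == 0) || (v == 0) then +oo%E
  else `| divcount R A u - divcount R A v |%E.

(* A ranges over infinite sets of positive integers; the shift n.+1 makes the
   argument of F and G run over the positive integers. *)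
Definition propP (R : realType) (F G : {poly int}) : Prop :=
  forall A : set nat, A `<=` [set a | (0 < a)%N] -> infinite_set A ->
    limn_esup (fun n : nat => ext_diff R A F.[n.+1%:Z] G.[n.+1%:Z]) = +oo%E.

Definition intersective (H : {poly int}) : Prop :=
  forall m : nat, (1 <= m)%N -> exists n : int, (H.[n] = 0 %[mod m%:Z])%Z.

Definition coprime_over_Q (F G : {poly int}) : bool :=
  coprimep (map_poly (intr : int -> rat) F) (map_poly (intr : int -> rat) G).

(* Main.v *)
Require Import Defs.
From mathcomp Require Import all_boot all_order all_algebra finmap.
From mathcomp Require Import all_classical all_reals all_analysis.
From mathcomp Require Import ring lra zify.
Import GRing.Theory.
Local Open Scope ring_scope.
Set Implicit Arguments.
Unset Strict Implicit.
Unset Printing Implicit Defensive.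
Import Order.TTheory Num.Theory.

(** If neither [F] nor [G] is intersective, there are moduli [m1] and [m2]
dividing no value of [F], respectively of [G]; then no multiple of [m1 * m2]
divides any value of either polynomial, and the set of these multiples makes
every extended difference vanish.

Conversely let [F] be intersective. Coprimality gives a nonzero integer [c]
which every common divisor of [F(n)] and [G(n)] divides ([coprime_resultant]).
Choose many elements of [A], all at most [M], and put [L = |c| M!]. Some
residue class [n0] mod [L] satisfies [L | F(n)], so all the chosen elements
divide [F(n)]. It remains to find [n] in this class for which [G(n)] has a
number of divisors bounded in terms of [F] and [G] alone, whatever the size of
[L]. A prime factor [p] of [L] contributes to [G(n)] only within a divisor of
[c], because [p |c|] still divides [L], hence [F(n)]. So [G(n) = g h] where [g]
divides [c] and [h] is prime to [L], and the point is to choose [n] such that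
[h] has no prime factor below a fixed power of [n]: then [h] has a bounded
number of prime factors ([divisors_rough_mul], [rough_polynomial_value]).

The existence of such [n] is a lower-bound sieve with sifting level a power of
the length of the interval. Brun's pure sieve does not reach such a level, and
would leave an unbounded number of prime factors; [brun_hooley] is the
Brun-Hooley sieve. The primes are cut into blocks [2^2^j < p <= 2^2^j.+1], over
each of which the sum of [1/p] is at most 2 by Chebyshev's argument
([sum_inv_primes_block]). On each block the indicator function of avoiding all
the forbidden classes is bracketed by two truncated inclusion-exclusion sums,
and the brackets of all blocks are multiplied together ([sieve_pair_step]). The
truncation level grows linearly as the blocks descend, while the logarithm of
the primes decreases geometrically: the losses in the main term add up to less
than one half, and the moduli which occur stay below a fixed power of the
largest prime ([sieve_iterate]). *)

(** * Truncated inclusion-exclusion *)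

(** The inclusion-exclusion expansion of [\prod_(p <- s) (1 - x p)] cut after
the products of [b] variables. The recursion makes it available for
indicator functions, for densities and for counts alike. *)
Fixpoint bonf (R : pzRingType) (x : nat -> R) (b : nat) (s : seq nat) : R :=
  match s, b with
  | p :: s', b'.+1 => bonf x b s' - x p * bonf x b' s'
  | _, _ => 1
  end.

Section Bonferroni.
Variable R : realFieldType.
Implicit Types (x w : nat -> R) (s : seq nat) (b : nat).

Lemma bonf0 x s : bonf x 0 s = 1. Proof. by case: s. Qed.

(** The Bonferroni inequalities, valid for all weights in [0, 1] and not only
for indicator values: the same statement serves pointwise and on average. *)
Lemma bonf_alternates w b s : (forall p, p \in s -> 0 <= w p <= 1) ->
  0 <= (-1) ^+ b * (bonf w b s - \prod_(p <- s) (1 - w p)).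
Proof.
elim: s b => [|p s IHs] b ws; first by case: b => [|b]; rewrite /= big_nil subrr mulr0.
have wp : 0 <= w p <= 1 by apply: ws; rewrite mem_head.
have {}IHs b' := IHs b' (fun q qs => ws q (mem_behead (s := p :: s) qs)).
rewrite big_cons; case: b => [|b].
  have := IHs 0; rewrite !bonf0 !expr0 !mul1r => V1.
  have : 0 <= \prod_(q <- s) (1 - w q).
    rewrite big_seq; apply: prodr_ge0 => q qs.
    by have := ws q (mem_behead (s := p :: s) qs); lra.
  nra.
have /= := (IHs b.+1, IHs b); rewrite !exprS; case.
set V := \prod_(_ <- _) _; set U := bonf _ _ _; set U' := bonf _ _ _.
set e := (-1) ^+ b => h1 h2.
suff -> : -1 * e * (U - w p * U' - (1 - w p) * V) =
  -1 * e * (U - V) + w p * (e * (U' - V)) by rewrite addr_ge0// mulr_ge0//; lra.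
ring.
Qed.

(** Two consecutive truncations differ by the elementary symmetric function of
degree [b.+1], and Rankin's trick bounds it by a product: its multiple by
[tau ^+ b.+1] is one of the nonnegative terms of [\prod (1 + tau * w p)]. *)
Lemma bonf_gap w (tau : R) b s : 0 <= tau -> (forall p, p \in s -> 0 <= w p) ->
  0 <= (-1) ^+ b * (bonf w b s - bonf w b.+1 s) * tau ^+ b.+1
    <= \prod_(p <- s) (1 + tau * w p).
Proof.
move=> tau0; elim: s b => [|p s IHs] b ws.
  by case: b => [|b] /=; rewrite big_nil subrr mulr0 mul0r lexx ler01.
have wp : 0 <= w p by apply: ws; rewrite mem_head.
have {}IHs b' := IHs b' (fun q qs => ws q (mem_behead (s := p :: s) qs)).
have V1 : 1 <= \prod_(q <- s) (1 + tau * w q).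
  rewrite big_seq; elim/big_ind: _ => // [y z|q qs]; first by nra.
  by have := ws q (mem_behead (s := p :: s) qs); nra.
rewrite big_cons; case: b => [|b].
  have := IHs 0%N; rewrite /= !bonf0 !expr0 !expr1 !mul1r mulr1.
  have a0 : 0 <= tau * w p by apply: mulr_ge0.
  have : 0 <= tau * w p * (\prod_(q <- s) (1 + tau * w q) - 1) by rewrite mulr_ge0// subr_ge0.
  lra.
have /= := (IHs b.+1, IHs b); rewrite !(exprS _ b.+1) (exprS _ b); case.
set V := \prod_(_ <- _) _; set U := bonf _ b _; set U' := bonf _ b.+1 _.
set U'' := bonf _ b.+2 _.
set e := (-1) ^+ b; set t := tau ^+ b.+1 => h1 h2.
suff -> : -1 * e * (U' - w p * U - (U'' - w p * U')) * (tau * t) =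
  -1 * e * (U' - U'') * (tau * t) + tau * w p * (e * (U - U') * t).
  have : 0 <= tau * w p by apply: mulr_ge0.
  nra.
ring.
Qed.

(** At negated weights all signs are positive, so this is the sum of the
absolute values of the terms; it measures the error of the sieve. *)
Lemma bonf_opp_le w b s : (forall p, p \in s -> 0 <= w p) ->
  0 <= bonf (fun p => - w p) b s <= (1 + \sum_(p <- s) w p) ^+ b.
Proof.
elim: s b => [|p s IHs] b ws.
  by case: b => [|b]; rewrite /= big_nil addr0 expr1n lexx ler01.
have wp : 0 <= w p by apply: ws; rewrite mem_head.
have {}IHs b' := IHs b' (fun q qs => ws q (mem_behead (s := p :: s) qs)).
case: b => [|b]; first by rewrite /= expr0 lexx ler01.
have /= := (IHs b.+1, IHs b); case.
have S0 : 0 <= \sum_(q <- s) w q.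
  by rewrite big_seq; apply: sumr_ge0 => q qs; apply: ws; rewrite in_cons qs orbT.
rewrite big_cons; set S := \sum_(_ <- _) _ in S0 *.
set N := bonf _ _ _; set N' := bonf _ _ _ => h1 h2.
have le1 : (1 + S) ^+ b <= (1 + (w p + S)) ^+ b by rewrite lerXn2r ?nnegrE//; lra.
have : 0 <= (1 + S) ^+ b by rewrite exprn_ge0//; lra.
rewrite mulNr opprK; move: h1; rewrite !exprS; nra.
Qed.
End Bonferroni.

(** * Equidistribution in residue classes *)

Section Equidistribution.
Variable R : realFieldType.
Implicit Types (f g : nat -> R) (s : seq nat) (T q a : nat).

(** [f] has mean [mu] on every residue class to a modulus [q] prime to [s], with
an error [E] uniform in [q]. Asking this for all such [q] is what allows
multiplication by a function periodic modulo a new prime. *)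
Definition equidist T s f (mu E : R) :=
  forall q a, (0 < q)%N -> (forall p, p \in s -> coprime q p) ->
  `| \sum_(t < T | t == a %[mod q]) f t - T%:R * mu / q%:R | <= E.

Lemma equidist_le T s f mu E E' :
  E <= E' -> equidist T s f mu E -> equidist T s f mu E'.
Proof. by move=> EE h q a q0 cq; apply: le_trans EE; exact: h. Qed.

Lemma equidist_sub T s s' f mu E :
  {subset s <= s'} -> equidist T s f mu E -> equidist T s' f mu E.
Proof. by move=> ss h q a q0 cq; apply: h => // p /ss; exact: cq. Qed.

Lemma equidist_eq T s f g mu E :
  f =1 g -> equidist T s f mu E -> equidist T s g mu E.
Proof. by move=> fg h q a q0 cq; under eq_bigr do rewrite -fg; exact: h. Qed.

Lemma equidistB T s f g mu nu E E' :
  equidist T s f mu E -> equidist T s g nu E' ->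
  equidist T s (fun t => f t - g t) (mu - nu) (E + E').
Proof.
move=> hf hg q a q0 cq; rewrite sumrB mulrBr mulrBl.
rewrite (_ : _ - _ - _ = (\sum_(t < T | t == a %[mod q]) f t - T%:R * mu / q%:R)
  - (\sum_(t < T | t == a %[mod q]) g t - T%:R * nu / q%:R)); last by ring.
by apply: le_trans (ler_normB _ _) _; apply: lerD; [exact: hf|exact: hg].
Qed.

(** Passing from [T] to [T.+1], both sides grow exactly when [T] is congruent to
[a]. *)
Lemma count_residue T q a : (0 < q)%N ->
  (\sum_(t < T | t == a %[mod q]) 1 = (T + (q.-1 - a %% q)) %/ q)%N.
Proof.
move=> q0; have aq := ltn_pmod a q0; elim: T => [|T IH].
  by rewrite big_ord0 add0n divn_small//; lia.
rewrite big_mkcond big_ord_recr/= -big_mkcond/= IH addSn divnS// addnC.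
congr (_ + _)%N.
have -> : (q %| (T + (q.-1 - a %% q)).+1)%N = (T == a %[mod q]).
  have -> : ((T + (q.-1 - a %% q)).+1 = (T %/ q).+1 * q + T %% q - a %% q)%N.
    by have := divn_eq T q; lia.
  have Tq := ltn_pmod T q0.
  have [Ta|Ta|->] := ltngtP (T %% q) (a %% q).
  - apply/negbTE/negP => /dvdnP [k kE].
    have : (T %/ q * q < k * q < (T %/ q).+1 * q)%N by lia.
    by rewrite !ltn_pmul2r//; lia.
  - apply/negbTE/negP => /dvdnP [k kE].
    have : ((T %/ q).+1 * q < k * q < (T %/ q).+2 * q)%N by lia.
    by rewrite !ltn_pmul2r//; lia.
  - by rewrite addnK dvdn_mull// eqxx.
by case: (_ == _).
Qed.

Lemma equidist1 T : equidist T [::] (fun=> 1) 1 1.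
Proof.
move=> q a q0 _.
have -> : \sum_(t < T | t == a %[mod q]) 1 = (\sum_(t < T | t == a %[mod q]) 1)%N%:R :> R.
  by rewrite natr_sum.
rewrite count_residue// mulr1.
set m := (_ - _)%N; have mq : (m < q)%N by rewrite /m; lia.
have := divn_eq (T + m) q; have := ltn_pmod (T + m) q0.
set k := (_ %/ _)%N; set r := (_ %% _)%N => rq kE.
have qR : 0 < q%:R :> R by rewrite ltr0n.
rewrite -[k%:R](mulfK (lt0r_neq0 qR)) -mulrBl normrM normfV (gtr0_norm qR).
rewrite ler_pdivrMr// mul1r -natrM.
have -> : T%:R = (k * q)%:R + r%:R - m%:R :> R by rewrite -natrD -kE natrD addrK.
have -> : (k * q)%:R - ((k * q)%:R + r%:R - m%:R) = m%:R - r%:R :> R by ring.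
have : r%:R <= q%:R :> R by rewrite ler_nat ltnW.
have : m%:R <= q%:R :> R by rewrite ler_nat ltnW.
have : 0 <= r%:R :> R by []. have : 0 <= m%:R :> R by [].
by rewrite ler_norml; lra.
Qed.

End Equidistribution.

Section Sieve.
Variables (R : realFieldType) (chi : nat -> nat -> bool).
Hypothesis chi_mod : forall p t, chi p (t %% p) = chi p t.
Implicit Types (f : nat -> R) (s : seq nat) (T : nat).

(** [chi p t] means that [t] lies in a class modulo [p] to be sieved out. *)
Definition nroots p : nat := \sum_(c < p) chi p c.
Definition dens p : R := (nroots p)%:R / p%:R.

(** By the Chinese remainder theorem, a class modulo [q] cut by the forbidden
classes modulo [p] is a union of [nroots p] classes modulo [q * p]. *)
Lemma equidist_mul T s f mu E p : prime p -> (forall q, q \in s -> coprime p q) ->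
  equidist T s f mu E ->
  equidist T (p :: s) (fun t => (chi p t)%:R * f t) (dens p * mu) ((nroots p)%:R * E).
Proof.
move=> pp cp h q a q0 cq.
have p0 := prime_gt0 pp.
have cqp : coprime q p by apply: cq; rewrite mem_head.
have -> : \sum_(t < T | t == a %[mod q]) (chi p t)%:R * f t =
    \sum_(c < p) (chi p c)%:R * \sum_(t < T | t == chinese q p a c %[mod q * p]) f t.
  under [RHS]eq_bigr do rewrite big_distrr /=.
  rewrite (exchange_big_dep (fun t : 'I_T => t == a %[mod q])) /=; last first.
    by move=> c t _; rewrite chinese_remainder// chinese_modl// => /andP[].
  apply: eq_bigr => t ta.
  rewrite (big_pred1 (Ordinal (ltn_pmod t p0))) /= ?chi_mod// => c.
  rewrite chinese_remainder// chinese_modl// chinese_modr// ta /=.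
  by rewrite -val_eqE /= (modn_small (ltn_ord c)) eq_sym.
have -> : T%:R * (dens p * mu) / q%:R =
    \sum_(c < p) (chi p c)%:R * (T%:R * mu / (q * p)%N%:R).
  rewrite -mulr_suml -natr_sum -/(nroots p) /dens natrM; field.
  by rewrite !pnatr_eq0 -!lt0n q0 p0.
rewrite -sumrB; apply: le_trans (ler_norm_sum _ _ _) _.
rewrite natr_sum mulr_suml; apply: ler_sum => c _.
rewrite -mulrBr normrM normr_nat ler_wpM2l//.
apply: h; first by rewrite muln_gt0 q0.
by move=> r rs; rewrite coprimeMl cp// cq// in_cons rs orbT.
Qed.

Lemma equidist_bonf T s0 f mu E b s : all prime (s ++ s0) -> uniq (s ++ s0) ->
  equidist T s0 f mu E ->
  equidist T (s ++ s0) (fun t => f t * bonf (fun p => (chi p t)%:R) b s)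
    (mu * bonf dens b s) (E * bonf (fun p => - (nroots p)%:R) b s).
Proof.
elim: s b s0 f mu E => [|p s IHs] b s0 f mu E.
  case: b => [|b] _ _ /=; rewrite !mulr1 => h; apply: equidist_eq h => t; by rewrite mulr1.
rewrite cat_cons => /= /andP[pp aps] /andP[pn us] h.
case: b => [|b].
  rewrite !mulr1; apply: (equidist_sub (s := s0)).
    by move=> q qs; rewrite in_cons mem_cat qs !orbT.
  by apply: equidist_eq h => t; rewrite mulr1.
have us' : uniq (s ++ p :: s0) by rewrite (perm_uniq (permEl (perm_catCA s [:: p] s0))) /= pn.
have as' : all prime (s ++ p :: s0) by rewrite (perm_all _ (permEl (perm_catCA s [:: p] s0))) /= pp.
have cp q : q \in s0 -> coprime p q.
  move=> qs; rewrite prime_coprime// dvdn_prime2//.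
    by apply: contraNneq pn => ->; rewrite mem_cat qs orbT.
  by apply: (allP aps); rewrite mem_cat qs orbT.
have sub : {subset s ++ s0 <= p :: s ++ s0}.
  by move=> q qs; rewrite in_cons qs orbT.
have sub' : {subset s ++ p :: s0 <= p :: s ++ s0}.
  by move=> q; rewrite !(mem_cat, in_cons) orbCA.
have h1 := equidist_sub sub (IHs b.+1 s0 f mu E aps us h).
have h2 := equidist_sub sub' (IHs b (p :: s0) _ _ _ as' us' (equidist_mul pp cp h)).
have -> : mu * bonf dens b.+1 (p :: s) =
  mu * bonf dens b.+1 s - dens p * mu * bonf dens b s by rewrite /=; ring.
set rho := fun q => - (nroots q)%:R.
have -> : E * bonf rho b.+1 (p :: s) =
  E * bonf rho b.+1 s + (nroots p)%:R * E * bonf rho b s by rewrite /= /rho; ring.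
apply: equidist_eq (equidistB h1 h2) => t /=; ring.
Qed.
End Sieve.

(** * Sums over primes *)

Definition primes_in (a b : nat) := [seq p <- iota a.+1 (b - a) | prime p].

Lemma mem_primes_in a b p : (p \in primes_in a b) = [&& prime p, (a < p)%N & (p <= b)%N].
Proof. by rewrite mem_filter mem_iota; case: (prime p) => //=; lia. Qed.

Lemma primes_in_uniq a b : uniq (primes_in a b).
Proof. by rewrite filter_uniq// iota_uniq. Qed.

Lemma primes_in_prime a b : all prime (primes_in a b).
Proof. exact: filter_all. Qed.

Lemma primes_in_cat a b c : (a <= b <= c)%N ->
  primes_in a b ++ primes_in b c = primes_in a c.
Proof.
move=> abc; rewrite -filter_cat /primes_in.
have -> : b.+1 = (a.+1 + (b - a))%N by lia.
rewrite -iotaD; congr [seq p <- iota _ _ | prime p]; lia.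
Qed.

Lemma prod_primes_dvd s n : uniq s -> all prime s -> {in s, forall p, (p %| n)%N} ->
  (\prod_(p <- s) p %| n)%N.
Proof.
elim: s => [|p s IHs] /=; first by rewrite big_nil dvd1n.
move=> /andP[pn us] /andP[pp aps] dv; rewrite big_cons Gauss_dvd.
  by rewrite dv ?mem_head// IHs// => q qs; apply: dv; rewrite in_cons qs orbT.
rewrite prime_coprime// big_seq; elim/big_ind: _ => [|x y|q qs].
- by rewrite dvdn1; case: (p) pp => [|[]].
- by rewrite Euclid_dvdM// negb_or => -> ->.
- rewrite dvdn_prime2 ?(allP aps _ qs)//.
  by apply: contraNneq pn => ->.
Qed.

Lemma prime_dvd_fact p m : prime p -> (p %| m`!)%N -> (p <= m)%N.
Proof.
move=> pp; elim: m => [|m IHm]; first by rewrite fact0 dvdn1; case: (p) pp => [|[]].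
by rewrite factS Euclid_dvdM// => /orP[/dvdn_leq->//|/IHm/leqW].
Qed.

Lemma bin_le_exp2 n m : ('C(n, m) <= 2 ^ n)%N.
Proof.
have [nm|mn] := ltnP n m; first by rewrite bin_small.
rewrite -[2%N]/(1 + 1)%N expnDn (bigD1 (Ordinal (mn : m < n.+1)%N)) //=.
by rewrite !exp1n !muln1 leq_addr.
Qed.

(** Chebyshev: the primes in [(m, 2m]] all divide ['C(2m, m)], which is at most
[4 ^ m]. *)
Lemma dyadic_primes_count i : (i * size (primes_in (2 ^ i) (2 ^ i.+1)) <= 2 * 2 ^ i)%N.
Proof.
set s := primes_in _ _; set m := (2 ^ i)%N.
have d : (\prod_(p <- s) p %| 'C(2 * m, m))%N.
  apply: prod_primes_dvd; rewrite ?primes_in_uniq ?primes_in_prime// => p.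
  rewrite mem_primes_in expnS -/m => /and3P[pp mp pm].
  have : (p %| (2 * m)`!)%N by rewrite dvdn_fact// prime_gt0.
  have le : (m <= 2 * m)%N by lia.
  rewrite -(bin_fact le) Euclid_dvdM// => /orP[//|].
  rewrite (_ : 2 * m - m = m)%N; last by lia.
  by rewrite Euclid_dvdM// orbb => /(prime_dvd_fact pp); lia.
have le1 : (m ^ size s <= \prod_(p <- s) p)%N.
  have : all (fun p => m <= p)%N s.
    by apply/allP => p; rewrite mem_primes_in => /and3P[_ /ltnW].
  elim: (s) => [|p t IHt] /=; first by rewrite big_nil.
  by move=> /andP[mp /IHt]; rewrite big_cons expnS => /(leq_mul mp).
have le2 : (m ^ size s <= 2 ^ (2 * m))%N.
  apply: leq_trans (bin_le_exp2 _ m); apply: leq_trans le1 (dvdn_leq _ d).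
  by rewrite bin_gt0; lia.
by move: le2; rewrite /m -expnM leq_exp2l.
Qed.

Section PrimeSums.
Variable R : realType.

Lemma sum_inv_primes_dyadic n e : (0 < n)%N ->
  \sum_(p <- primes_in (2 ^ n) (2 ^ (n + e))) p%:R^-1 <= (2 * e)%:R / n%:R :> R.
Proof.
move=> n0; elim: e => [|e IHe].
  by rewrite muln0 mul0r addn0 /primes_in subnn big_nil.
rewrite -(@primes_in_cat _ (2 ^ (n + e))); last by rewrite !leq_exp2l//; lia.
rewrite big_cat /= mulnS natrD mulrDl [leRHS]addrC; apply: lerD => //.
set i := (n + e)%N; rewrite addnS -/i.
have i0 : (0 < 2 ^ i)%N by rewrite expn_gt0.
apply: (@le_trans _ _ (\sum_(p <- primes_in (2 ^ i) (2 ^ i.+1)) (2 ^ i)%:R^-1)).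
  rewrite big_seq [leRHS]big_seq; apply: ler_sum => p.
  rewrite mem_primes_in => /and3P[pp ip _].
  by rewrite lef_pV2 ?posrE ?ltr0n ?(prime_gt0 pp)// ler_nat ltnW.
rewrite big_const_seq count_predT iter_addr addr0.
rewrite -[leLHS]mulr_natl ler_pdivrMr ?ltr0n// mulrAC ler_pdivlMr ?ltr0n//.
rewrite -!natrM ler_nat mulnC; apply: leq_trans (dyadic_primes_count i).
by rewrite leq_mul2r leq_addr orbT.
Qed.

(** This block consists of [2 ^ j] dyadic intervals, over each of which
the sum of [1/p] is at most [2 / 2 ^ j]. *)
Lemma sum_inv_primes_block j :
  \sum_(p <- primes_in (2 ^ 2 ^ j) (2 ^ 2 ^ j.+1)) p%:R^-1 <= 2 :> R.
Proof.
have j0 : (0 < 2 ^ j)%N by rewrite expn_gt0.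
have := sum_inv_primes_dyadic (2 ^ j) j0.
rewrite (_ : 2 ^ j + 2 ^ j = 2 ^ j.+1)%N; last by rewrite expnS; lia.
by rewrite natrM mulfK// pnatr_eq0 -lt0n.
Qed.

(** The constant [c] controls each block uniformly: it bounds at once the terms
of high degree of the inclusion-exclusion and the inverse of the proportion
of integers that survive. *)
Lemma prod_dens_block d : exists c, forall chi j,
  (forall p, p \in primes_in (2 ^ 2 ^ j) (2 ^ 2 ^ j.+1) -> (nroots chi p <= d)%N) ->
  \prod_(p <- primes_in (2 ^ 2 ^ j) (2 ^ 2 ^ j.+1)) (1 + 4 * dens R chi p) <= 4 ^+ c.
Proof.
pose x : R := expR (8 * d%:R).
exists (Num.bound x) => chi j chid.
have x0 : 0 <= x by rewrite expR_ge0.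
apply: (@le_trans _ _ x); last first.
  apply: le_trans (ltW (archi_boundP x0)) _.
  have : (Num.bound x)%:R <= (4 ^ Num.bound x)%N%:R :> R.
    by rewrite ler_nat ltnW// ltn_expl.
  by rewrite natrX.
apply: (@le_trans _ _ (expR (\sum_(p <- primes_in (2 ^ 2 ^ j) (2 ^ 2 ^ j.+1))
    (4 * d%:R * p%:R^-1)))); last first.
  rewrite ler_expR -mulr_sumr (_ : 8 * d%:R = 4 * d%:R * 2); last by ring.
  by rewrite ler_wpM2l ?sum_inv_primes_block// mulr_ge0.
rewrite expR_sum big_seq [leRHS]big_seq; apply: ler_prod => p pb.
have w0 : 0 <= dens R chi p by rewrite divr_ge0.
rewrite addr_ge0 ?mulr_ge0//=; apply: le_trans (expR_ge1Dx _).
by rewrite lerD2l -mulrA ler_wpM2l// ler_wpM2r ?invr_ge0// ler_nat chid.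
Qed.
End PrimeSums.

(** * The Brun-Hooley sieve *)

Section BrunHooley.
Variables (R : realFieldType) (chi : nat -> nat -> bool).
Hypothesis chi_mod : forall p t, chi p (t %% p) = chi p t.
Implicit Types (s B : seq nat) (T : nat).

Definition avoids s t : R := \prod_(p <- s) (1 - (chi p t)%:R).

(** An upper bound [P] and a lower bound [L] for the indicator function of the
integers avoiding the classes modulo the primes of [s], both equidistributed.
A lower bound for a product of factors needs upper bounds for the others, so
the two must be carried together. *)
Definition sieve_pair T s (mu lam M : R) := exists P L : nat -> R,
  [/\ equidist T s P mu M, equidist T s L lam M,
      forall t, avoids s t <= P t & forall t, L t <= avoids s t].

Lemma avoids_itv s t : 0 <= avoids s t <= 1.
Proof.
rewrite /avoids; elim/big_ind: _ => [|x y|p _]; first by rewrite ler01 lexx.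
  by nra.
by case: chi; rewrite ?subrr ?subr0 ?lexx ?ler01.
Qed.

Lemma dens_ge0 p : 0 <= dens R chi p. Proof. by rewrite divr_ge0. Qed.

(** With [X], [Y] the indicators for [B] and [s], [u' <= X <= u] and
[L <= Y <= P], one has [Y * X >= L * u - P * (u - u')]. The degree [b] is even,
so that [bonf] brackets [X] in this direction. *)
Lemma sieve_pair_step T s B b N mu lam M : ~~ odd b ->
  all prime (B ++ s) -> uniq (B ++ s) -> 0 <= M ->
  (1 + \sum_(p <- B) (nroots chi p)%:R) ^+ b.+1 <= N ->
  sieve_pair T s mu lam M ->
  sieve_pair T (B ++ s) (mu * bonf (dens R chi) b B)
    (lam * bonf (dens R chi) b B -
      mu * (bonf (dens R chi) b B - bonf (dens R chi) b.+1 B))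
    (3 * (M * N)).
Proof.
move=> bE pBs uBs M0 leN [P [L [eP eL leP leL]]].
pose u := fun t => bonf (fun p => (chi p t)%:R : R) b B.
pose u' := fun t => bonf (fun p => (chi p t)%:R : R) b.+1 B.
have S0 : 0 <= \sum_(p <- B) (nroots chi p)%:R :> R by apply: sumr_ge0.
have N0 b' : (b' <= b.+1)%N ->
    0 <= bonf (fun p => - (nroots chi p)%:R : R) b' B <= N.
  move=> b'b; have /andP[-> h] := bonf_opp_le (w := fun p => (nroots chi p)%:R) b' (s := B)
    (fun _ _ => ler0n R _).
  by apply: le_trans h (le_trans _ leN); rewrite ler_weXn2l//; lra.
have ePu := equidist_bonf chi_mod b pBs uBs eP.
have ePu' := equidist_bonf chi_mod b.+1 pBs uBs eP.
have eLu := equidist_bonf chi_mod b pBs uBs eL.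
have NM b' : (b' <= b.+1)%N -> M * bonf (fun p => - (nroots chi p)%:R) b' B <= M * N.
  by move=> /N0/andP[_ h]; rewrite ler_wpM2l.
have MN0 : 0 <= M * N by rewrite mulr_ge0//; have /andP[] := N0 0%N (leq0n _); exact: le_trans.
have X0 t := avoids_itv B t.
have Y0 t := avoids_itv s t.
have chi01 t p : p \in B -> 0 <= ((chi p t)%:R : R) <= 1.
  by move=> _; rewrite ler0n; case: chi; rewrite ?lexx ?ler01.
have uX t : avoids B t <= u t.
  by have := bonf_alternates b (chi01 t); rewrite -signr_odd (negbTE bE) mul1r subr_ge0.
have u'X t : u' t <= avoids B t.
  have := bonf_alternates b.+1 (chi01 t); rewrite exprS -signr_odd (negbTE bE) mulr1.
  by rewrite mulN1r oppr_ge0 subr_le0.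
have catE t : avoids (B ++ s) t = avoids B t * avoids s t by rewrite /avoids big_cat.
exists (fun t => P t * u t), (fun t => L t * u t - (P t * u t - P t * u' t)); split.
- by apply: equidist_le ePu; have := NM b (leqnSn _); lra.
- rewrite mulrBr; apply: equidist_le (equidistB eLu (equidistB ePu ePu')).
  by have := NM b (leqnSn _); have := NM b.+1 (leqnn _); lra.
- by move=> t; rewrite catE mulrC; apply: ler_pM => //; [case/andP: (Y0 t)|case/andP: (X0 t)].
- move=> t; rewrite catE -subr_ge0.
  rewrite (_ : _ - _ = (avoids s t - L t) * u t + (P t - avoids s t) * (u t - u' t) +
    avoids s t * (avoids B t - u' t)); last by ring.
  have /andP[x0 _] := X0 t; have /andP[y0 _] := Y0 t.
  have := uX t; have := u'X t; have := leP t; have := leL t => h1 h2 h3 h4.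
  by rewrite !addr_ge0// mulr_ge0//; lra.
Qed.

Lemma sum_nroots_le B z : (0 < z)%N -> {in B, forall p, (p <= z)%N} -> (size B < z)%N ->
  1 + \sum_(p <- B) (nroots chi p)%:R <= (z ^ 2)%:R :> R.
Proof.
move=> z0 Bz sB; rewrite -natr_sum addrC natr1 ler_nat.
have rho p : (nroots chi p <= p)%N.
  by rewrite -[leqRHS]card_ord -sum1_card leq_sum// => c _; case: chi.
have : (\sum_(p <- B) nroots chi p <= \sum_(p <- B) z)%N.
  rewrite big_seq [leqRHS]big_seq; apply: leq_sum => p /Bz.
  exact: leq_trans.
rewrite big_const_seq count_predT iter_addn_0 -mulnn; nia.
Qed.

(** The main term and the loss of one block. The lower bound comes from
[(1 - w) * (1 + 4 * w) >= 1] for [w <= 3 / 4]; the upper one is [bonf_gap] at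
[tau = 4]. *)
Lemma bonf_mean_bounds c b B :
  (forall p, p \in B -> 4 * dens R chi p <= 3) -> ~~ odd b ->
  \prod_(p <- B) (1 + 4 * dens R chi p) <= 4 ^+ c ->
  [/\ 4 ^- c <= bonf (dens R chi) b B,
   0 <= bonf (dens R chi) b B - bonf (dens R chi) b.+1 B &
   (bonf (dens R chi) b B - bonf (dens R chi) b.+1 B) * 4 ^+ b.+1 <= 4 ^+ c].
Proof.
move=> d34 bE Qc.
have w0 p : p \in B -> 0 <= dens R chi p by move=> _; exact: dens_ge0.
have w01 p : p \in B -> 0 <= dens R chi p <= 1.
  by move=> pB; have := d34 _ pB; have := w0 _ pB; lra.
have := bonf_gap b (tau := 4) (ler0n _ _) w0.
have := bonf_alternates b w01.
rewrite -signr_odd (negbTE bE) !mul1r subr_ge0 => Vu /andP[g0 g1].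
split; [apply: le_trans Vu| |exact: le_trans Qc].
  have Q0 : 0 < \prod_(p <- B) (1 + 4 * dens R chi p).
    by rewrite big_seq; apply: prodr_gt0 => p /w0; lra.
  have c0 : 0 < 4 ^+ c :> R by rewrite exprn_gt0.
  have : 1 <= (\prod_(p <- B) (1 - dens R chi p)) * \prod_(p <- B) (1 + 4 * dens R chi p).
    rewrite -big_split /= big_seq; elim/big_ind: _ => // [x y|p pB]; first by nra.
    have := w0 _ pB; have := d34 _ pB; nra.
  move=> h; rewrite -(ler_pM2r c0) mulVf ?lt0r_neq0//; apply: le_trans h _.
  apply: ler_wpM2l Qc; rewrite big_seq; apply: prodr_ge0 => p /w01; lra.
by move: g0; rewrite pmulr_lge0// exprn_gt0.
Qed.
End BrunHooley.

Section Iterate.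
Variables (R : realType) (d c : nat) (chi : nat -> nat -> bool).
Hypothesis chi_mod : forall p t, chi p (t %% p) = chi p t.
Hypothesis chi_d : forall p, prime p -> (2 ^ 2 ^ d < p)%N -> (nroots chi p <= d)%N.
Hypothesis dens_c : forall j,
  (forall p, p \in primes_in (2 ^ 2 ^ j) (2 ^ 2 ^ j.+1) -> (nroots chi p <= d)%N) ->
  \prod_(p <- primes_in (2 ^ 2 ^ j) (2 ^ 2 ^ j.+1)) (1 + 4 * dens R chi p) <= 4 ^+ c.

(** After the [k] highest blocks. The [i]-th block from the top is truncated at
degree [2 * (c + i)]; its relative loss is then at most [2 ^- i.+2], and the
losses sum to less than [1 / 2]. The last bound is a telescoped form of
[\sum_i 2 ^ (r - i) * (4 * (c + i) + 4) <= 2 ^ r * (8 * c + 16)]: the terms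
are the binary logarithms of the errors of the successive blocks. *)
Lemma sieve_iterate T r k : (k + d <= r)%N -> exists mu lam : R, exists l : nat,
  [/\ sieve_pair chi T (primes_in (2 ^ 2 ^ (r - k)) (2 ^ 2 ^ r)) mu lam (2 ^+ l),
      4 ^- (c * k) <= mu, mu * (2^-1 + 2 ^- k.+1) <= lam &
      (l + 2 ^ (r - k) * (8 * (c + k) + 16) <= 2 ^ r * (8 * c + 16))%N].
Proof.
elim: k => [|k IHk] kr.
  exists 1, 1, 0%N; split.
  - exists (fun=> 1), (fun=> 1); rewrite subn0 /primes_in subnn /= expr0.
    by split; try exact: equidist1; move=> t; rewrite /avoids big_nil.
  - by rewrite muln0 expr0 invr1.
  - by rewrite expr1; lra.
  - by rewrite subn0 addn0.
have [|mu [lam [l [sv mu_ge lam_ge l_le]]]] := IHk; first by lia.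
set j := (r - k.+1)%N; have jE : (r - k = j.+1)%N by lia.
rewrite jE in sv l_le.
set B := primes_in (2 ^ 2 ^ j) (2 ^ 2 ^ j.+1).
have dj : (d <= j)%N by lia.
have z0 i : (0 < 2 ^ 2 ^ i)%N by rewrite expn_gt0.
have Bd p : p \in B -> (nroots chi p <= d)%N.
  rewrite mem_primes_in => /and3P[pp jp _]; apply: chi_d => //.
  by apply: leq_ltn_trans jp; rewrite !leq_exp2l.
have B34 p : p \in B -> 4 * dens R chi p <= 3.
  move=> pB; have := Bd _ pB; move: pB; rewrite mem_primes_in => /and3P[pp jp _] pd.
  have p0 : 0 < p%:R :> R by rewrite ltr0n prime_gt0.
  rewrite mulrA ler_pdivrMr// -!natrM ler_nat.
  have d2 : (2 * d <= 2 ^ 2 ^ d)%N.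
    have : (2 ^ d.+1 <= 2 ^ 2 ^ d)%N by rewrite leq_exp2l// ltn_expl.
    by apply: leq_trans; rewrite expnS leq_mul2l /= ltnW// ltn_expl.
  have : (2 ^ 2 ^ d <= 2 ^ 2 ^ j)%N by rewrite !leq_exp2l.
  lia.
pose b := ((c + k) * 2)%N.
have bE : ~~ odd b by rewrite /b oddM andbF.
have [u_ge gap0 gap_le] := bonf_mean_bounds B34 bE (dens_c Bd).
set u := bonf _ b B in u_ge gap0 gap_le; set u' := bonf _ b.+1 B in gap0 gap_le.
have catB : B ++ primes_in (2 ^ 2 ^ j.+1) (2 ^ 2 ^ r) = primes_in (2 ^ 2 ^ j) (2 ^ 2 ^ r).
  by apply: primes_in_cat; rewrite !leq_exp2l//; lia.
have leN : (1 + \sum_(p <- B) (nroots chi p)%:R) ^+ b.+1 <=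
    2 ^+ (2 ^ j.+1 * 2 * b.+1) :> R.
  rewrite exprM lerXn2r ?nnegrE ?exprn_ge0// ?addr_ge0 ?sumr_ge0//.
  rewrite exprM -!natrX; apply: sum_nroots_le => //.
    by move=> p; rewrite mem_primes_in => /and3P[].
  rewrite size_filter; apply: leq_ltn_trans (count_size _ _) _; rewrite size_iota.
  by rewrite ltn_subrL !z0.
have := @sieve_pair_step R chi chi_mod T _ B b _ mu lam (2 ^+ l) bE _ _ _ leN sv.
rewrite catB primes_in_prime primes_in_uniq exprn_ge0// -/u -/u' => /(_ isT isT isT) sv'.
have mu0 : 0 < mu by apply: lt_le_trans mu_ge; rewrite invr_gt0 exprn_gt0.
have u0 : 0 < u by apply: lt_le_trans u_ge; rewrite invr_gt0 exprn_gt0.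
exists (mu * u), (lam * u - mu * (u - u')), (l + 2 + 2 ^ j.+1 * 2 * b.+1)%N; split.
- have [P [L [eP eL leP leL]]] := sv'.
  have le3 : 3 * (2 ^+ l * 2 ^+ (2 ^ j.+1 * 2 * b.+1)) <=
      2 ^+ (l + 2 + 2 ^ j.+1 * 2 * b.+1) :> R.
    rewrite !exprD.
    set x := 2 ^+ l; set y := 2 ^+ (_ * _).
    have : 0 <= x * y by rewrite mulr_ge0 ?exprn_ge0.
    lra.
  by exists P, L; split=> //; apply: equidist_le le3 _.
- by rewrite mulnS addnC exprD invfM; apply: ler_pM => //; rewrite invr_ge0 exprn_ge0.
- have c0 : 0 < 4 ^+ c :> R by rewrite exprn_gt0.
  have gap_u : u - u' <= u * 2 ^- k.+2.
    rewrite ler_pdivlMr ?exprn_gt0// -(ler_pM2r (_ : 0 < 4 ^+ b.+1)) ?exprn_gt0//.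
    have le4 : 4 ^+ c * 4 ^+ c * 2 ^+ k.+2 <= 4 ^+ b.+1 :> R.
      rewrite -!natrX -!natrM ler_nat (_ : 4 = 2 ^ 2)%N// -!expnM -!expnD leq_exp2l//.
      by rewrite /b; lia.
    have e0 : 0 < 2 ^+ k.+2 :> R by rewrite exprn_gt0.
    have cu : 1 <= u * 4 ^+ c by rewrite -ler_pdivrMr// div1r.
    rewrite mulrAC; apply: le_trans (ler_wpM2r (ltW e0) gap_le) _.
    apply: (@le_trans _ _ (u * (4 ^+ c * 4 ^+ c * 2 ^+ k.+2))); last by rewrite ler_wpM2l// ltW.
    rewrite mulrA ler_wpM2r ?(ltW e0)// mulrA.
    by rewrite -[leLHS]mul1r ler_wpM2r ?(ltW c0).
  have : mu * (u - u') <= mu * (u * 2 ^- k.+2) by rewrite ler_wpM2l// ltW.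
  have := ler_wpM2r (ltW u0) lam_ge.
  rewrite (_ : 2 ^- k.+1 = 2 * 2 ^- k.+2); last first.
    by rewrite [in RHS]exprS invfM mulrA divff ?mul1r// pnatr_eq0.
  set y := 2 ^- k.+2; lra.
- have : (0 < 2 ^ j)%N by rewrite expn_gt0.
  move: l_le; rewrite /b expnS; nia.
Qed.
End Iterate.

(** The interval has length a fixed power of the sifting level [2 ^ 2 ^ r], with
an exponent [m] depending only on the number [d] of forbidden classes per
prime. Nothing is sieved below [2 ^ 2 ^ d], since primes [p <= d] may have all
their classes forbidden. *)
Theorem brun_hooley (R : realType) d : exists m, forall r (chi : nat -> nat -> bool),
  (forall p t, chi p (t %% p)%N = chi p t) ->
  (forall p, prime p -> (2 ^ 2 ^ d < p)%N -> (nroots chi p <= d)%N) ->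
  exists2 t, (t < 2 ^ (m * 2 ^ r))%N &
    forall p, prime p -> (2 ^ 2 ^ d < p <= 2 ^ 2 ^ r)%N -> ~~ chi p t.
Proof.
have [c cP] := prod_dens_block R d.
exists (10 * c + 18)%N => r chi chi_mod chi_d.
have [rd|dr] := ltnP r d.
  exists 0%N => [|p _ /andP[dp pr]]; first by rewrite expn_gt0.
  have : (2 ^ 2 ^ r < 2 ^ 2 ^ d)%N by rewrite !ltn_exp2l.
  lia.
set T := (2 ^ _)%N.
have kr : (r - d + d <= r)%N by rewrite subnK.
have [mu [lam [l [[P [L [_ eL _ leL]]] mu_ge lam_ge l_le]]]] :=
  sieve_iterate chi_mod chi_d (cP chi) T kr.
rewrite (_ : r - (r - d) = d)%N in eL leL l_le; last by lia.
have lam_gt : 4 ^- (c * (r - d)) / 2 <= lam.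
  apply: le_trans lam_ge; apply: ler_pM => //.
  by rewrite lerDl invr_ge0 exprn_ge0.
have pos : 0 < \sum_(t < T | t == 0 %[mod 1]) L t.
  have /ler_normlP[lower _] := eL 1%N 0%N isT (fun p _ => coprime1n p).
  suff : 2 ^+ l < T%:R * lam by move: lower; rewrite divr1; lra.
  have q0 : 0 < 4 ^+ (c * (r - d)) :> R by rewrite exprn_gt0.
  apply: (@lt_le_trans _ _ (T%:R * (4 ^- (c * (r - d)) / 2))); last by rewrite ler_wpM2l.
  rewrite mulrA ltr_pdivlMr// ltr_pdivlMr//.
  rewrite -!natrX -!natrM ltr_nat (_ : 4 = 2 ^ 2)%N// -expnM -(expnSr 2 l) -expnD.
  rewrite ltn_exp2l//.
  have : (0 < 2 ^ d)%N by rewrite expn_gt0.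
  have : (r < 2 ^ r)%N by rewrite ltn_expl.
  move: l_le; set x := (2 ^ r)%N; set y := (2 ^ d)%N => h1 h2 h3.
  have : (c * (r - d) <= c * x)%N by rewrite leq_mul2l; lia.
  have : (y <= y * (8 * (c + (r - d)) + 16))%N by rewrite leq_pmulr//; lia.
  lia.
have [t tT Lt] : exists2 t, (t < T)%N & 0 < L t.
  apply: contrapT => no; move: pos; rewrite ltNge => /negP; apply.
  apply: sumr_le0 => t _; rewrite leNgt; apply/negP => Lt.
  by apply: no; exists t => //; exact: ltn_ord.
exists t => // p pp /andP[dp pr]; apply/negP => chip.
have : 0 < avoids R chi (primes_in (2 ^ 2 ^ d) (2 ^ 2 ^ r)) t.
  exact: lt_le_trans (leL t).
rewrite /avoids (bigD1_seq p) ?mem_primes_in ?pp ?dp ?pr ?primes_in_uniq//=.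
by rewrite chip subrr mul0r ltxx.
Qed.

(** * Numbers of divisors *)

(** A divisor of [p * n] divides [n] or is [p] times a divisor of [n]. *)
Lemma divisors_mul_prime p n : prime p -> (0 < n)%N ->
  (size (divisors (p * n)) <= 2 * size (divisors n))%N.
Proof.
move=> pp n0; have p0 := prime_gt0 pp.
rewrite mul2n -addnn -[X in (_ <= _ + X)%N](size_map (muln p)) -size_cat.
apply: uniq_leq_size (divisors_uniq _) _ => a.
rewrite -dvdn_divisors ?muln_gt0 ?p0// => apn; rewrite mem_cat.
have [pa|pa] := boolP (p %| a)%N.
  apply/orP; right; have /dvdnP[e aE] := pa; apply/mapP; exists e; last by rewrite mulnC.
  by rewrite -dvdn_divisors//; move: apn; rewrite aE mulnC dvdn_pmul2l.
apply/orP; left; rewrite -dvdn_divisors//; move: apn; rewrite Gauss_dvdr//.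
by rewrite coprime_sym prime_coprime.
Qed.

(** [h] has at most [s] prime factors, and each at most doubles the number of
divisors. *)
Lemma divisors_rough_mul z s g h : (0 < g)%N -> (0 < h)%N ->
  (forall p, prime p -> (p %| h)%N -> (z < p)%N) -> (h <= z ^ s)%N ->
  (size (divisors (g * h)) <= 2 ^ s * size (divisors g))%N.
Proof.
move=> g0; elim: s h => [|s IHs] h h0 hz hs.
  by have -> : h = 1%N; [rewrite expn0 in hs; lia|rewrite muln1 mul1n].
have [h1|h1] := leqP h 1.
  have -> : h = 1%N by lia.
  by rewrite muln1 leq_pmull// expn_gt0.
have pp := pdiv_prime h1; have /dvdnP[h' hE] := pdiv_dvd h.
set p := pdiv h in pp hE.
have zp : (z < p)%N by apply: hz => //; exact: pdiv_dvd.
have h'0 : (0 < h')%N by move: h0; rewrite hE muln_gt0 => /andP[].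
rewrite hE mulnA mulnC; apply: leq_trans (divisors_mul_prime pp _) _.
  by rewrite muln_gt0 g0.
rewrite expnS -mulnA leq_mul2l; apply: IHs => // [q qp qh|].
  by apply: hz => //; rewrite hE dvdn_mulr.
have z0 : (0 < z)%N.
  by rewrite lt0n; apply/eqP => zE; move: hs; rewrite zE exp0n//; lia.
rewrite -(leq_pmul2l z0) -expnS; apply: leq_trans hs; rewrite hE mulnC leq_mul2l.
by rewrite (ltnW zp) orbT.
Qed.

(** * Values of integer polynomials *)

(** The Bezout relation over the rationals, with denominators cleared. *)
Lemma coprime_resultant (F G : {poly int}) :
  coprimep (map_poly (intr : int -> rat) F) (map_poly (intr : int -> rat) G) ->
  exists2 c : int, c != 0 & forall n d : int, (d %| F.[n])%Z -> (d %| G.[n])%Z -> (d %| c)%Z.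
Proof.
case/Bezout_eq1_coprimepP => -[u v] /= uv.
have [U [a a0 uE]] := rat_poly_scale u; have [V [b b0 vE]] := rat_poly_scale v.
exists (a * b); first by rewrite mulf_neq0.
have E : b *: (U * F) + a *: (V * G) = (a * b)%:P.
  apply: (@map_inj_poly _ _ (intr : int -> rat)) => //; first exact: intr_inj.
  have aQ : a%:~R != 0 :> rat by rewrite intr_eq0.
  have bQ : b%:~R != 0 :> rat by rewrite intr_eq0.
  have UE : map_poly intr U = a%:~R *: u by rewrite uE scalerA mulfV ?scale1r.
  have VE : map_poly intr V = b%:~R *: v by rewrite vE scalerA mulfV ?scale1r.
  rewrite rmorphD /= !map_polyZ /= !rmorphM /= !map_polyC /= -polyCM UE VE.
  by rewrite -!scalerAl !scalerA [X in X *: _](mulrC b%:~R) -scalerDr uv alg_polyC.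
move=> n d dF dG; have /(congr1 (fun p => p.[n])) := E.
rewrite hornerD !hornerZ !hornerM hornerC => <-.
by rewrite rpredD// dvdz_mull// dvdz_mull.
Qed.

Lemma horner_int_bound (G : {poly int}) :
  exists C : nat, forall x : nat, (0 < x)%N -> (`|G.[x%:Z]| <= C * x ^ size G)%N.
Proof.
exists (\sum_(i < size G) `|(G`_i)%R|)%N => x x0.
rewrite horner_coef big_distrl /=.
apply: (@leq_trans (\sum_(i < size G) `|(G`_i * x%:Z ^+ i)%R|)%N).
  elim/big_ind2: _ => // a b c e ab ce.
  by apply: leq_trans (leq_add ab ce); rewrite -lez_nat PoszD !abszE ler_normD.
apply: leq_sum => i _; rewrite abszM abszX leq_mul2l; apply/orP; right.
by rewrite absz_nat leq_pexp2l// ltnW.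
Qed.

(** The residues counted are roots of the reduction of [H] in ['F_p], which is
not zero. *)
Lemma nroots_poly_le (H : {poly int}) p : prime p -> ~~ (p%:Z %| lead_coef H)%Z ->
  (\sum_(c < p) (p%:Z %| H.[c%:Z])%Z <= size H)%N.
Proof.
move=> pp pH; have pch := pchar_Fp pp.
pose Hp : {poly 'F_p} := map_poly intr H.
have rootE c : (p%:Z %| H.[c%:Z])%Z = root Hp c%:R.
  by rewrite (dvdz_pcharf pch) /root /Hp -horner_map /= -[c%:R]/(c%:Z%:~R).
pose s := [seq c <- iota 0 p | root Hp c%:R].
have -> : (\sum_(c < p) (p%:Z %| H.[c%:Z])%Z = size [seq c%:R : 'F_p | c <- s])%N.
  rewrite size_map size_filter -sum1_count -[in iota 0 p](subn0 p).
  rewrite [RHS]big_mkcond big_mkord. apply: eq_bigr => c _; by rewrite rootE; case: root.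
apply: ltnW; have Hp0 : Hp != 0.
  apply/eqP => /(congr1 (fun q : {poly 'F_p} => q`_(size H).-1)).
  by rewrite coef_map coef0 => /eqP; rewrite -(dvdz_pcharf pch) (negbTE pH).
apply: (@leq_trans (size Hp)) (size_poly _ _); apply: max_poly_roots => //.
  by apply/allP => _ /mapP[c + ->]; rewrite mem_filter => /andP[].
rewrite map_inj_in_uniq ?filter_uniq ?iota_uniq// => a b.
rewrite !mem_filter !mem_iota => /andP[_ /andP[_ ap]] /andP[_ /andP[_ bp]].
by move/(congr1 val); rewrite /= !val_Fp_nat// !modn_small.
Qed.

Lemma dvdz_horner_sub (G : {poly int}) (x y : int) : (x - y %| G.[x] - G.[y])%Z.
Proof.
have /factor_theorem[q qE] : root (G - G.[y]%:P) y by rewrite /root !hornerE subrr.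
have := congr1 (fun p => p.[x]) qE; rewrite !hornerE => ->.
exact: dvdz_mull.
Qed.

Lemma dvdz_horner_eqmod (G : {poly int}) (d x y : int) :
  (d %| x - y)%Z -> (d %| G.[x])%Z = (d %| G.[y])%Z.
Proof.
move=> dxy; have dG := dvdz_trans dxy (dvdz_horner_sub G x y).
by rewrite -[in LHS](subrK G.[y] G.[x]) rpredDl.
Qed.

(** Here [s] and [y] depend on [G] only, so that the number of prime factors of
[G(n)] outside those of [L] is bounded independently of the progression. The
primes up to [y] have to divide [L]: they are too small for the sieve or may
divide the leading coefficient of [G]. *)
Lemma rough_polynomial_value (R : realType) (G : {poly int}) : G != 0 ->
  exists s y : nat, forall n0 L : nat, (0 < n0)%N -> (0 < L)%N ->
    (forall p, prime p -> (p <= y)%N -> (p %| L)%N) ->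
  exists t z : nat, let Gn := G.[(n0 + L * t)%N%:Z] in
    (forall p, prime p -> ~~ (p %| L)%N -> (p%:Z %| Gn)%Z -> (z < p)%N) /\
    (`|Gn| <= z ^ s)%N.
Proof.
move=> G0; pose d := size G; have [m sieve] := brun_hooley R d.
have [C GC] := horner_int_bound G.
exists (m * d).+1, (2 ^ 2 ^ d + `|lead_coef G|)%N => n0 L n00 L0 yL.
(* The sifting level [2 ^ 2 ^ r] exceeds [r], hence absorbs this bound on the
   size of the progression. *)
pose r := (C * (n0 + L) ^ d)%N.
pose chi p t := ~~ (p %| L)%N && (p%:Z %| G.[(n0 + L * t)%N%:Z])%Z.
have chi_mod p t : chi p (t %% p)%N = chi p t.
  rewrite /chi; congr (_ && _); apply: dvdz_horner_eqmod.
  have {2}-> := divn_eq t p; apply/dvdzP; exists (- (L * (t %/ p))%N%:Z).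
  by rewrite !PoszD !PoszM; ring.
have chi_d p : prime p -> (2 ^ 2 ^ d < p)%N -> (nroots chi p <= d)%N.
  move=> pp dp; have [pL|pL] := boolP (p %| L)%N.
    by rewrite /nroots big1// => c _; rewrite /chi pL.
  pose q : {poly int} := L%:Z *: 'X + n0%:Z%:P.
  have L0' : L%:Z != 0 by rewrite -lt0n in L0 *; lia.
  have sq : size q = 2.
    by rewrite size_polyDl ?size_scale ?size_polyX// size_polyC; case: eqP.
  have HE c : (G \Po q).[c%:Z] = G.[(n0 + L * c)%N%:Z].
    by rewrite horner_comp /q !hornerE PoszD PoszM addrC.
  have -> : nroots chi p = (\sum_(c < p) (p%:Z %| (G \Po q).[c%:Z])%Z)%N.
    by apply: eq_bigr => c _; rewrite HE /chi pL.
  have -> : d = size (G \Po q) by rewrite size_comp_poly2.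
  apply: nroots_poly_le => //; rewrite lead_coef_comp ?sq//.
  have -> : lead_coef q = L%:Z.
    by rewrite lead_coefE sq /= /q coefD coefZ coefX coefC mulr1 addr0.
  rewrite dvdzE abszM abszX !absz_nat Euclid_dvdM// Euclid_dvdX// negb_or.
  rewrite (contra (fun h => dvdn_leq _ h)) ?absz_gt0 ?lead_coef_eq0//=.
    by rewrite (negbTE pL).
  rewrite -ltnNge ltnNge; apply/negP => le; move/negP: pL; apply; apply: yL => //.
  exact: leq_trans le (leq_addl _ _).
have [t tT tP] := sieve r chi chi_mod chi_d.
exists t, (2 ^ 2 ^ r)%N; split=> [p pp pL pG|].
  rewrite ltnNge; apply/negP => pz.
  suff dp : (2 ^ 2 ^ d < p)%N.
    by have := tP p pp; rewrite dp pz /chi pL pG => /(_ isT).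
  rewrite ltnNge; apply/negP => le; move/negP: pL; apply; apply: yL => //.
  exact: leq_trans le (leq_addr _ _).
apply: leq_trans (GC _ _) _; first by rewrite addn_gt0 n00.
have le1 : (n0 + L * t <= (n0 + L) * 2 ^ (m * 2 ^ r))%N by nia.
have le2 : (r <= 2 ^ 2 ^ r)%N.
  by apply: (@leq_trans (2 ^ r)); rewrite ?leq_exp2l// ltnW// ltn_expl.
apply: (@leq_trans (C * ((n0 + L) * 2 ^ (m * 2 ^ r)) ^ d)).
  by rewrite leq_mul2l leq_exp2r ?le1 ?orbT// size_poly_gt0.
rewrite expnMn mulnA -/r expnS; apply: leq_mul => //.
by rewrite -!expnM leq_exp2l//; lia.
Qed.

(** * Divisors in an infinite set *)

Definition count_divisors (A : set nat) (n : nat) := count (fun a => `[< A a >]) (divisors n).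

Lemma divcountE (R : realType) (A : set nat) (m : int) : m != 0 ->
  divcount R A m = (count_divisors A `|m|)%:R%:E.
Proof.
move=> m0; rewrite /divcount /counting /count_divisors.
have -> : [set a : nat | A a /\ (a%:Z %| m)%Z]%classic =
    [set` [fset a in [seq a <- divisors `|m| | `[< A a >]]]%fset]%classic.
  apply/seteqP; split=> a /=; rewrite inE mem_filter -dvdn_divisors ?absz_gt0//.
    by case=> /asboolP -> /=; rewrite dvdzE absz_nat.
  by case/andP=> /asboolP Aa; rewrite dvdzE absz_nat.
rewrite asboolT; last exact: finite_fset.
by rewrite set_fsetK card_fseq undup_id ?size_filter// filter_uniq// divisors_uniq.
Qed.

(** The heart of the matter: along a progression on which [F(n)] is divisible by
many elements of [A], some [G(n)] has few divisors altogether. *)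
Lemma divisor_counts_separated (R : realType) (F G : {poly int}) (A : set nat) :
  G != 0 -> coprime_over_Q F G -> intersective F ->
  (A `<=` [set a | (0 < a)%N])%classic -> infinite_set A ->
  forall K N : nat, exists2 n : nat, (N <= n)%N &
    F.[n.+1%:Z] != 0 -> G.[n.+1%:Z] != 0 ->
    (count_divisors A `|G.[n.+1%:Z]| + K <= count_divisors A `|F.[n.+1%:Z]|)%N.
Proof.
move=> G0 /coprime_resultant[c c0 cP] iF Apos Ainf K N.
have [s [y sy]] := rough_polynomial_value R G0.
have c0' : (0 < `|c|)%N by rewrite absz_gt0.
have [B BA kB] := infinite_set_fset (K + 2 ^ s * size (divisors `|c|)) Ainf.
(* Every prime [p] dividing [L] divides [M!], so that [p * |c|] divides [L]. *)
have [M ME] : exists M : nat, M = (y + `|c| + \sum_(b <- B) b)%N by eexists.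
have [L LE] : exists L : nat, L = (`|c| * M`!)%N by eexists.
have L0 : (0 < L)%N by rewrite LE muln_gt0 c0' fact_gt0.
have [n1 n1F] := iF L L0.
pose n0 := (`|(n1 %% L)%Z| + L * N.+1)%N.
have n0N : (N < n0)%N by rewrite /n0; nia.
have [||t [z [rough small]]] := sy n0 L _ L0; first by lia.
  move=> p pp py; rewrite LE dvdn_mull// dvdn_fact// prime_gt0//=.
  by rewrite ME -addnA; lia.
set n := (n0 + L * t)%N in rough small.
have nE : n = n.-1.+1 by rewrite prednK// /n; lia.
exists n.-1; first by rewrite /n; lia.
rewrite -nE; move=> Fn0 Gn0.
have LF : (L%:Z %| F.[n%:Z])%Z.
  rewrite (@dvdz_horner_eqmod _ _ _ n1).
    by apply/dvdz_mod0P; rewrite n1F mod0z.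
  have L0z : L%:Z != 0 by lia.
  apply/dvdzP; exists (N.+1%:Z + t%:Z - (n1 %/ L)%Z).
  have E (l u v q e : int) : e + l * u + l * v - (q * l + e) = (u + v - q) * l by ring.
  rewrite /n /n0 !PoszD (PoszM L t) (PoszM L N.+1) gez0_abs ?modz_ge0//.
  by rewrite [X in _ - X](divz_eq n1 L) E.
have [F0 Gp] : (0 < `|F.[n%:Z]|)%N /\ (0 < `|G.[n%:Z]|)%N by rewrite !absz_gt0.
have le1 : (K + 2 ^ s * size (divisors `|c|) <= count_divisors A `|F.[n%:Z]|)%N.
  apply: leq_trans kB _; rewrite /count_divisors -size_filter.
  apply: uniq_leq_size => // b bB; have Ab : A b by exact: BA.
  rewrite mem_filter asboolT//= -dvdn_divisors//.
  apply: (@dvdn_trans L); last by move: LF; rewrite dvdzE absz_nat.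
  rewrite LE dvdn_mull// dvdn_fact//; have -> : (0 < b)%N by exact: Apos.
  by rewrite /= ME (big_rem b)//= addnCA leq_addr.
apply: leq_trans le1; rewrite addnC leq_add2l.
apply: leq_trans (count_size _ _) _.
(* The part of [G(n)] supported on the primes of [L] divides [c], so that the
   cofactor [h] of [g] is prime to [L]. *)
pose g := gcdn `|G.[n%:Z]| `|c|.
have g0 : (0 < g)%N by rewrite gcdn_gt0 Gp.
have /dvdnP[h hE] : (g %| `|G.[n%:Z]|)%N by exact: dvdn_gcdl.
have h0 : (0 < h)%N by move: Gp; rewrite hE muln_gt0 => /andP[].
apply: (@leq_trans (2 ^ s * size (divisors g))); last first.
  rewrite leq_mul2l; apply/orP; right; apply: uniq_leq_size (divisors_uniq _) _ => a.
  by rewrite -!dvdn_divisors// => /dvdn_trans; apply; exact: dvdn_gcdr.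
rewrite hE mulnC; apply: (@divisors_rough_mul z) => // [p pp ph|]; last first.
  by apply: leq_trans small; rewrite hE leq_pmulr.
have pG : (p * g %| `|G.[n%:Z]|)%N by rewrite hE dvdn_mul.
apply: rough => //; last by rewrite dvdzE absz_nat (dvdn_trans _ pG)// dvdn_mulr.
apply/negP => pL.
have pM : (p %| M`!)%N.
  move: pL; rewrite LE Euclid_dvdM// => /orP[pc|//].
  rewrite dvdn_fact// prime_gt0//=; apply: leq_trans (dvdn_leq c0' pc) _.
  by rewrite ME addnAC leq_addl.
(* [p * |c|] divides [L], so [p * g] divides both values, hence [c]: this
   contradicts the maximality of [g]. *)
have pgL : (p * g %| L)%N by rewrite LE mulnC dvdn_mul// dvdn_gcdr.
have pgc : (p * g %| `|c|)%N.
  have := cP n%:Z (p * g)%N%:Z; rewrite !dvdzE absz_nat; apply=> //.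
  by apply: dvdn_trans pgL _; move: LF; rewrite dvdzE absz_nat.
have : (p * g %| g)%N by rewrite dvdn_gcd pG.
by move/(dvdn_leq g0); rewrite leqNgt -[X in (X < _)%N]mul1n ltn_pmul2r// prime_gt1.
Qed.

Lemma limn_esup_pinfty (R : realType) (u : nat -> \bar R) :
  (forall K N : nat, exists2 n : nat, (N <= n)%N & (K%:R%:E <= u n)%E) ->
  limn_esup u = +oo%E.
Proof.
move=> h; rewrite /limn_esup limf_esupE; apply/eqP; rewrite -leye_eq.
apply/ereal_infP => _ [V [N _ NV] <-].
suff -> : ereal_sup [set u x | x in V]%classic = +oo%E by [].
apply: eq_infty => r.
have [n Nn un] := h (Num.bound `|r|) N.
apply: le_trans (ereal_sup_ubound _); last by exists n => //; exact: NV.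
apply: le_trans un; rewrite lee_fin ltW// (le_lt_trans (ler_norm r))//.
exact: archi_boundP.
Qed.

Lemma ext_diffC (R : realType) (A : set nat) (u v : int) :
  ext_diff R A u v = ext_diff R A v u.
Proof.
rewrite /ext_diff andbC orbC; case: ifP => // _; case: ifP => // /norP[v0 u0].
by rewrite !divcountE// -!EFinB !abse_EFin distrC.
Qed.

Lemma propP_sym (R : realType) (F G : {poly int}) : propP R F G -> propP R G F.
Proof.
move=> h A A0 Ai; rewrite -(h A A0 Ai); congr limn_esup.
by apply/funext => n; exact: ext_diffC.
Qed.

Lemma intersective_propP (R : realType) (F G : {poly int}) :
  G != 0 -> coprime_over_Q F G -> intersective F -> propP R F G.
Proof.
move=> G0 FG iF A A0 Ai; apply: limn_esup_pinfty => K N.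
have [n Nn hn] := divisor_counts_separated R G0 FG iF A0 Ai K N.
exists n => //; rewrite /ext_diff.
have [Fn|Fn] := eqVneq F.[n.+1%:Z] 0; have [Gn|Gn] := eqVneq G.[n.+1%:Z] 0 => /=; last 3 first.
- exact: leey.
- exact: leey.
- rewrite !divcountE// -EFinB abse_EFin lee_fin.
  apply: le_trans (ler_norm _); rewrite lerBrDr -natrD ler_nat addnC.
  exact: hn.
- have [c c0 cP] := coprime_resultant FG.
  by have := cP n.+1%:Z 0; rewrite Fn Gn dvd0z (negbTE c0) => /(_ isT isT).
Qed.

Lemma not_intersective (H : {poly int}) : ~ intersective H ->
  exists2 m : nat, (0 < m)%N & forall n : int, ~~ (m%:Z %| H.[n])%Z.
Proof.
move=> nH; apply: contrapT => no; apply: nH => m m0; apply: contrapT => nm.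
apply: no; exists m => // n; apply/negP => /dvdz_mod0P Hn.
by apply: nm; exists n; rewrite mod0z.
Qed.

(** For multiples of [m1 * m2] both counts are zero at every [n]. *)
Lemma not_intersective_not_propP (R : realType) (F G : {poly int}) :
  ~ intersective F -> ~ intersective G -> ~ propP R F G.
Proof.
move=> /not_intersective[m1 m10 F1] /not_intersective[m2 m20 G2].
pose m := (m1 * m2)%N; have m0 : (0 < m)%N by rewrite muln_gt0 m10.
pose A := [set a | (0 < a)%N /\ (m %| a)%N]%classic.
have A0 : (A `<=` [set a | (0 < a)%N])%classic by move=> a [].
have Ai : infinite_set A.
  apply/infinite_set_fsetP => k.
  exists [fset a in [seq (m * i.+1)%N | i <- iota 0 k]]%fset.
    move=> a /=; rewrite inE => /mapP[i _ ->].
    by split; [rewrite muln_gt0 m0|rewrite dvdn_mulr].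
  rewrite card_fseq undup_id ?size_map ?size_iota// map_inj_uniq ?iota_uniq// => x y /eqP.
  by rewrite eqn_pmul2l// => /eqP[].
move=> /(_ A A0 Ai).
have none (H : {poly int}) k n : (k %| m)%N -> (forall x : int, ~~ (k%:Z %| H.[x])%Z) ->
    H.[n] != 0 /\ count_divisors A `|H.[n]| = 0%N.
  move=> km Hk; have Hn : H.[n] != 0 by apply: contraNneq (Hk n) => ->; rewrite dvdz0.
  split=> //; apply/eqP; rewrite -leqn0 leqNgt -has_count; apply/hasPn => a.
  rewrite -dvdn_divisors ?absz_gt0// => aH; apply/negP => /asboolP[_ ma].
  by move/negP: (Hk n); apply; rewrite dvdzE absz_nat (dvdn_trans km)// (dvdn_trans ma).
have -> : (fun n : nat => ext_diff R A F.[n.+1%:Z] G.[n.+1%:Z]) = cst 0%E.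
  apply/funext => n; rewrite /ext_diff /=.
  have [Fn cF] := none F m1 n.+1%:Z (dvdn_mulr _ (dvdnn _)) F1.
  have [Gn cG] := none G m2 n.+1%:Z (dvdn_mull _ (dvdnn _)) G2.
  by rewrite (negbTE Fn) (negbTE Gn)/= !divcountE// cF cG subee// abse0.
by rewrite (cvg_limn_einf_sup (cvg_cst _)).2.
Qed.

Theorem theorem1p1 (R : realType) (F G : {poly int})
    (hF : F != 0) (hG : G != 0) (hFG : coprime_over_Q F G) :
  propP R F G <-> (intersective F \/ intersective G).
Proof.
split=> [h|[iF|iG]].
- apply: contrapT => /not_orP[nF nG]; exact: not_intersective_not_propP nF nG h.
- exact: intersective_propP.
- apply: propP_sym; apply: intersective_propP => //.
  by rewrite /coprime_over_Q coprimep_sym.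
Qed.
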